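(* $$\int_0^{\infty} e^{-x^2}\cos(x)\,dx = \frac{\sqrt{\pi}}{2}\,e^{-1/4}.$$ *)

(* Defs.v *)
From HB Require Import structures.
From mathcomp Require Export all_boot all_order all_algebra.
From mathcomp Require Export all_classical all_reals all_analysis.

Export Order.TTheory GRing.Theory Num.Theory.
Export numFieldNormedType.Exports.

(* Main.v *)
Require Import Defs.
From mathcomp Require Import measurable_realfun ring.

(* Let C t be the integral of exp(- x^2) cos(t x) over [0, +oo[. Differentiating
   under the integral sign and then integrating by parts gives
   C' t = - t / 2 * C t, so C t * exp(t^2 / 4) is constant, equal to its value
   at t = 0, the Gauss integral. *)

Local Open Scope classical_set_scope.
Local Open Scope ring_scope.

(** Dominated convergence, with [|f|] as bound, makes the integral the limit of those over
    [[a, a + n]], which the compact FTC evaluates. Integrability is a hypothesis because [f] may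
    change sign, as it does in the integration by parts below. *)
Lemma integrable_itvcy_FTC2 {R : realType} {f F : R -> R} {a l : R} :
  (@lebesgue_measure R).-integrable `[a, +oo[ (EFin \o f) -> continuous f ->
  (forall x : R, is_derive x (1 : R) F (f x)) -> F x @[x --> +oo] --> l ->
  \int[lebesgue_measure]_(x in `[a, +oo[) f x = l - F a.
Proof.
move=> intf cf dF Fl.
have contF : continuous F.
  move=> x; apply/differentiable_continuous/derivable1_diffP.
  by have [] := dF x.
pose f_ n := (EFin \o f) \_ `[a, a + n%:R].
have [] // := @dominated_convergence _ _ _ (@lebesgue_measure R) `[a, +oo[
    _ f_ (EFin \o f) (abse \o (EFin \o f)).
- move=> n; apply/measurable_restrict => //.
  apply/measurable_EFinP/measurable_funTS.
  exact: continuous_measurable_fun.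
- by apply/measurable_EFinP/measurable_funTS; exact: continuous_measurable_fun.
- apply: aeW => x /=; rewrite in_itv/= andbT => ax.
  apply: cvg_near_cst; near=> n.
  rewrite /f_ patchE mem_set//= in_itv/= ax/=.
  rewrite -lerBlDl; near: n; exact: nbhs_infty_ger.
- exact: integrable_abse.
- apply: aeW => x n _ /=; rewrite /f_ patchE; case: ifPn => // _.
  by rewrite abse0.
move=> _ _ cvg_int.
rewrite /Rintegral; move/cvg_lim : cvg_int => <-//.
rewrite (_ : limn _ = (l - F a)%:E)//; apply/cvg_lim => //.
(* The compact FTC asks for [a < a + n], hence [0 < n]; the limit only needs this for large [n]. *)
have intE n : (0 < n)%N ->
    (\int[lebesgue_measure]_(x in `[a, +oo[) f_ n x)%E =
      (F (a + n%:R) - F a)%:E.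
  move=> n0; rewrite /f_ -integral_mkcondr setIidr; last first.
    by move=> x /=; rewrite !in_itv/= andbT => /andP[].
  rewrite (continuous_FTC2 (F := F)) ?EFinB//.
  - by rewrite ltrDl ltr0n.
  - exact: continuous_subspaceT.
  - split => //.
    + by apply: cvg_at_right_filter; exact: contF.
    + by apply: cvg_at_left_filter; exact: contF.
  - by move=> x _; rewrite derive1E; apply: derive_val.
have : (F (a + n%:R) - F a)%:E @[n --> \oo] --> (l - F a)%:E.
  apply: cvg_EFin; first exact: nearW.
  apply: cvgB; last exact: cvg_cst.
  (* The limit of [F] along the reals passes to the sequence [a + n], which tends to [+oo]. *)
  apply: (cvg_pinftyP F l).1 => //; apply/cvgryPge => r.
  by near do rewrite -lerBlDl; exact: nbhs_infty_ger.
apply: cvg_trans; apply: near_eq_cvg; near=> n => /=.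
by rewrite intE//; near: n; exact: nbhs_infty_gt.
Unshelve. all: end_near. Qed.

Lemma is_derive_gauss_fun {R : realType} (x : R) :
  is_derive x (1 : R) gauss_fun (- (2 * x * gauss_fun x)).
Proof.
have dsqr : is_derive x (1 : R) (fun y => - y ^+ 2) (- (2 * x)).
  apply: is_derive_eq; rewrite /GRing.scale/=; ring.
have dE :=
  @is_derive1_comp _ expR (fun y => - y ^+ 2) _ _ _ (is_derive_expR _) dsqr.
refine (is_derive_eq dE _).
by rewrite /gauss_fun; ring.
Qed.

Lemma is_derive_sinM {R : realType} (t x : R) :
  is_derive x (1 : R) (fun y => sin (t * y)) (t * cos (t * x)).
Proof.
have dM : is_derive x (1 : R) (fun y => t * y) t.
  by apply: is_derive_eq; rewrite /GRing.scale/=; ring.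
refine (is_derive_eq
  (@is_derive1_comp _ sin ( *%R t) _ _ _ (is_derive_sin _) dM) _).
by rewrite mulrC.
Qed.

Lemma is_derive_cosM {R : realType} (t x : R) :
  is_derive t (1 : R) (fun s => cos (s * x)) (- (x * sin (t * x))).
Proof.
have dM : is_derive t (1 : R) (fun s => s * x) x.
  by apply: is_derive_eq; rewrite /GRing.scale/=; ring.
refine (is_derive_eq
  (@is_derive1_comp _ cos ( *%R^~ x) _ _ _ (is_derive_cos _) dM) _).
by rewrite mulNr mulrC.
Qed.

(** Used to dominate the oscillating integrands by [gauss_fun] and by [2 * x * gauss_fun x]. The
    bound is required only for [a <= x] since the second of these is negative for [x < 0]. *)
Lemma le_integrable_itvcy {R : realType} {f h : R -> R} {a : R} :
  continuous f -> (forall x, a <= x -> `|f x| <= h x) ->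
  (@lebesgue_measure R).-integrable `[a, +oo[ (EFin \o h) ->
  (@lebesgue_measure R).-integrable `[a, +oo[ (EFin \o f).
Proof.
move=> cf fh; apply: le_integrable => //.
  by apply/measurable_EFinP/measurable_funTS; exact: continuous_measurable_fun.
move=> x /=; rewrite in_itv/= andbT => ax.
by rewrite lee_fin (le_trans (fh _ ax))// ler_norm.
Qed.

Lemma integrable0y_gauss {R : realType} :
  (@lebesgue_measure R).-integrable `[0, +oo[ (EFin \o gauss_fun).
Proof. by apply: integrableS integrableT_gauss. Qed.

Lemma continuous_id_gauss {R : realType} :
  continuous (fun x : R => 2 * x * gauss_fun x).
Proof.
move=> x; apply: cvgM; last exact: continuous_gauss_fun.
by apply: cvgM; [exact: cvg_cst|exact: cvg_id].
Qed.

(** The factor 2 makes [- gauss_fun] an exact antiderivative. As the integrand is nonnegative on the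
    half-line, the FTC computes the integral of its absolute value. *)
Lemma integrable0y_id_gauss {R : realType} :
  (@lebesgue_measure R).-integrable `[0, +oo[
    (EFin \o (fun x => 2 * x * gauss_fun x)).
Proof.
have ge0 (x : R) : 0 <= x -> 0 <= 2 * x * gauss_fun x.
  by move=> x0; rewrite !mulr_ge0// gauss_fun_ge0.
have dG (x : R) :
    is_derive x (1 : R) (fun y => - gauss_fun y) (2 * x * gauss_fun x).
  have dg := is_derive_gauss_fun x.
  by apply: is_derive_eq; rewrite opprK.
apply/integrableP; split.
  apply/measurable_EFinP/measurable_funTS.
  by apply: continuous_measurable_fun; exact: continuous_id_gauss.
under eq_integral.
  move=> x; rewrite inE/= in_itv/= andbT => x0.
  rewrite ger0_norm ?ge0//; over.
(* The limit at infinity is given as [- 0], the form produced by [cvgN]. The resulting value is a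
   real number, so finiteness is immediate. *)
rewrite (@ge0_continuous_FTC2y _ _ (fun y => - gauss_fun y) 0 (- 0)) ?ltry//.
- by apply: continuous_subspaceT; exact: continuous_id_gauss.
- by apply: cvgN; exact: cvg_gauss_fun.
- by apply: cvg_at_right_filter; apply: cvgN; exact: continuous_gauss_fun.
- by move=> x _; rewrite derive1E; have [] := dG x.
Qed.

Lemma continuous_cosM {R : realType} (t : R) :
  continuous (fun x => cos (t * x)).
Proof.
move=> x; apply: continuous_comp; last exact: continuous_cos.
by apply: cvgM; [exact: cvg_cst|exact: cvg_id].
Qed.

Lemma continuous_sinM {R : realType} (t : R) :
  continuous (fun x => sin (t * x)).
Proof.
move=> x; apply: continuous_comp; last exact: continuous_sin.
by apply: cvgM; [exact: cvg_cst|exact: cvg_id].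
Qed.

Lemma integrable0y_gauss_cos {R : realType} (t : R) :
  (@lebesgue_measure R).-integrable `[0, +oo[
    (EFin \o (fun x => gauss_fun x * cos (t * x))).
Proof.
apply: le_integrable_itvcy integrable0y_gauss.
  move=> x; apply: cvgM; first exact: continuous_gauss_fun.
  exact: continuous_cosM.
move=> x _; rewrite normrM ger0_norm ?gauss_fun_ge0//.
by rewrite ler_piMr ?gauss_fun_ge0// cos_max.
Qed.

Lemma integrable0y_id_gauss_sin {R : realType} (t : R) :
  (@lebesgue_measure R).-integrable `[0, +oo[
    (EFin \o (fun x => 2 * x * gauss_fun x * sin (t * x))).
Proof.
apply: le_integrable_itvcy integrable0y_id_gauss.
  move=> x; apply: cvgM; first exact: continuous_id_gauss.
  exact: continuous_sinM.
move=> x x0; rewrite normrM ger0_norm ?mulr_ge0 ?gauss_fun_ge0//.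
by rewrite ler_piMr ?mulr_ge0 ?gauss_fun_ge0// sin_max.
Qed.

(** The right integrand minus the left one is the derivative of [gauss_fun x * sin (t * x)], which
    vanishes at 0 and at infinity, so the difference integrates to 0. *)
Lemma gauss_cos_by_parts {R : realType} (t : R) :
  \int[lebesgue_measure]_(x in `[0, +oo[) (2 * x * gauss_fun x * sin (t * x)) =
  t * \int[lebesgue_measure]_(x in `[0, +oo[) (gauss_fun x * cos (t * x)).
Proof.
have intC := integrable0y_gauss_cos t.
have intS := integrable0y_id_gauss_sin t.
have intCt : (@lebesgue_measure R).-integrable `[0, +oo[
    (EFin \o (fun x => t * (gauss_fun x * cos (t * x)))).
  exact: (integrableZl _ t intC).
apply/esym/eqP; rewrite -RintegralZl// -subr_eq0 -RintegralB//; apply/eqP.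
have dF (x : R) : is_derive x (1 : R) (fun y => gauss_fun y * sin (t * y))
    (t * (gauss_fun x * cos (t * x)) - 2 * x * gauss_fun x * sin (t * x)).
  have dg := is_derive_gauss_fun x; have ds := is_derive_sinM t x.
  by apply: is_derive_eq; rewrite /GRing.scale/=; ring.
rewrite (integrable_itvcy_FTC2 (l := 0) _ _ dF).
- by rewrite mulr0 sin0 mulr0 subr0.
- exact: (integrableB _ intCt intS).
- move=> x; apply: cvgB.
    apply: cvgM; first exact: cvg_cst.
    by apply: cvgM; [exact: continuous_gauss_fun|exact: continuous_cosM].
  by apply: cvgM; [exact: continuous_id_gauss|exact: continuous_sinM].
- apply: norm_cvg0; apply: (@squeeze_cvgr _ _ _ _ (cst 0) gauss_fun).
  + apply: nearW => x /=; rewrite normr_ge0/= normrM ger0_norm ?gauss_fun_ge0//.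
    by rewrite ler_piMr ?gauss_fun_ge0// sin_max.
  + exact: cvg_cst.
  + exact: cvg_gauss_fun.
Qed.

(** The derivative of the integrand in [s] is bounded by an integrable function independent of [s],
    so differentiation passes under the integral; integration by parts then brings back [C t]. *)
Lemma is_derive_gauss_cos {R : realType} (t : R) :
  let C s :=
    \int[lebesgue_measure]_(x in `[0, +oo[) (gauss_fun x * cos (s * x)) in
  is_derive t (1 : R) C (- (t / 2 * C t)).
Proof.
move=> C.
pose f (s x : R) := gauss_fun x * cos (s * x).
(* The factor [- 2^-1] is split off to leave exactly the integrand of [gauss_cos_by_parts]. *)
have df (s x : R) :
    is_derive s (1 : R) (f ^~ x) (- 2^-1 * (2 * x * gauss_fun x * sin (s * x))).
  have dc := is_derive_cosM s x.
  by apply: is_derive_eq; rewrite /GRing.scale/=; field.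
(* The radius 1 is arbitrary: the bound below is uniform in [s]. *)
have tI : `](t - 1), (t + 1)[%classic t.
  by rewrite /= in_itv/= ltrBlDr ltrDl ltr01.
have intf (s : R) : `](t - 1), (t + 1)[%classic s ->
    (@lebesgue_measure R).-integrable `[0, +oo[ (EFin \o f s).
  by move=> _; exact: integrable0y_gauss_cos.
have d1f s x : `](t - 1), (t + 1)[%classic s -> `[0%R, +oo[%classic x ->
    derivable (f ^~ x) s 1.
  by move=> _ _; apply: ex_derive.
(* The absolute value makes the dominating function nonnegative on all of [R], not just on the
   half-line. *)
have G0 (x : R) : 0 <= `|2 * x * gauss_fun x| by [].
have intG : (@lebesgue_measure R).-integrable `[0, +oo[
    (EFin \o (fun x => `|2 * x * gauss_fun x|)).
  exact: (integrable_norm integrable0y_id_gauss).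
have ubG s x : `](t - 1), (t + 1)[%classic s -> `[0%R, +oo[%classic x ->
    `|partial1of2 f s x| <= `|2 * x * gauss_fun x|.
  (* Both [1/2] and [|sin (s * x)|] are bounded by 1. *)
  move=> _ _; rewrite partial1of2E derive_val normrM [in leLHS]normrM.
  rewrite -[leRHS]mul1r ler_pM// ?normrN.
    by rewrite ger0_norm// invf_le1// ler1n.
  by rewrite ler_piMr// sin_max.
apply: DeriveDef.
  exact: (derivable_under_integral _ tI intf d1f G0 intG ubG).
rewrite -derive1E (differentiation_under_integral _ tI intf d1f G0 intG ubG)//.
under eq_Rintegral do rewrite partial1of2E derive_val.
rewrite RintegralZl//; last exact: integrable0y_id_gauss_sin.
by rewrite gauss_cos_by_parts /C; field.
Qed.

Theorem theorem4p3 (R : realType) :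
  (\int[@lebesgue_measure R]_(x in `[0%R, +oo[) (expR (- (x ^+ 2)) * cos x)%:E
   = (Num.sqrt (pi : R) / 2 * expR (- (1 / 4)))%:E)%E.
Proof.
pose C s :=
  \int[@lebesgue_measure R]_(x in `[0, +oo[) (gauss_fun x * cos (s * x)).
have C0 : C 0 = Num.sqrt pi / 2.
  rewrite /C; under eq_Rintegral do rewrite mul0r cos0 mulr1.
  by rewrite /Rintegral integral0y_gauss.
have C1 : C 1 = C 0 * expR (- (1 / 4)).
  have : C 1 * expR (1 ^+ 2 / 4) = C 0 * expR (0 ^+ 2 / 4).
    apply: (@is_derive_0_is_cst _ (fun t => C t * expR (t ^+ 2 / 4))) => t.
    have dC := is_derive_gauss_cos t.
    have dq : is_derive t (1 : R) (fun s => s ^+ 2 / 4) (t / 2).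
      by apply: is_derive_eq; rewrite /GRing.scale/=; field.
    have dE := @is_derive1_comp _ expR
      (fun s => s ^+ 2 / 4) _ _ _ (is_derive_expR _) dq.
    (* The two terms of the product rule are [t / 2 * C t * expR (t ^+ 2 / 4)] and its opposite. *)
    refine (is_derive_eq (is_deriveM dC dE) _).
    by rewrite /GRing.scale/= /C; field.
  rewrite expr0n/= mul0r expR0 mulr1 expr1n => <-.
  by rewrite -mulrA -expRD subrr expR0 mulr1.
(* The goal is an equality of extended reals, while [C] is a real-valued integral; removing [fine]
   requires the integral to be finite, which integrability provides. *)
rewrite -C0 -C1 /C /Rintegral fineK.
  by apply: eq_integral => x _; rewrite mul1r.
by apply: integrable_fin_num => //; exact: integrable0y_gauss_cos.
Qed.
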